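(* Let $\mathcal{K}$ be a finite set of positive integers. Suppose $\alpha_r \in \mathcal{R}$ for $r \in \mathcal{K} \cup \{0\}$, and let \[ P(u) = \sum_{r \in \mathcal{K} \cup \{0\}} \alpha_r u^r \in \mathcal{R}[u]. \] Suppose that for some $k \in \mathcal{K}$: (i) $p \nmid k$; (ii) for every positive integer $v$, $p^v k \notin \mathcal{K}$; (iii) $\alpha_k \notin \mathcal{Q}$. Then the sequence $(P(u) \bmod \mathcal{Z})_{u \in \mathcal{Z}}$ is well-distributed in $\mathcal{T}$.
   Context: Fix a finite field $\mathbb{F}_q$ of characteristic $p$. Let $\mathcal{Z} = \mathbb{F}_q[t]$, $\mathcal{Q} = \mathbb{F}_q(t)$, and $\mathcal{R} = \mathbb{F}_q((t^{-1})) = \{\sum_{n=-\infty}^N c_n t^n : N \in \mathbb{Z}, c_n \in \mathbb{F}_q\}$, the completion of $\mathcal{Q}$ with respect to the absolute value $|u/v| = q^{\deg u - \deg v}$. Let $\mathcal{T} = \mathcal{R}/\mathcal{Z}$, a compact group; each element of $\mathcal{T}$ has a unique representative of the form $\sum_{n=-\infty}^{-1} c_n t^n$. For $M \in \mathbb{N}$ and $a_1, \ldots, a_M \in \mathbb{F}_q$, the cylinder set $C(M; a_1, \ldots, a_M)$ is the set of elements of $\mathcal{T}$ whose representative $\sum_{n \le -1} c_n t^n$ satisfies $c_{-1} = a_1, \ldots, c_{-M} = a_M$. A Følner sequence in $\mathcal{Z}$ is a sequence $(F_N)_{N \in \mathbb{N}}$ of finite nonempty subsets of $\mathcal{Z}$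 such that $|F_N \cap (F_N + u)|/|F_N| \to 1$ as $N \to \infty$ for every $u \in \mathcal{Z}$. A sequence $(a(u))_{u \in \mathcal{Z}}$ in $\mathcal{T}$ is uniformly distributed with respect to a Følner sequence $(F_N)$ if for every $M \in \mathbb{N}$ and $a_1, \ldots, a_M \in \mathbb{F}_q$, $|\{u \in F_N : a(u) \in C(M; a_1, \ldots, a_M)\}|/|F_N| \to q^{-M}$; it is well-distributed if it is uniformly distributed with respect to every Følner sequence in $\mathcal{Z}$. *)

(* Defs.v *)
From HB Require Import structures.
From mathcomp Require Import all_boot all_order all_algebra.
Set Implicit Arguments. Unset Strict Implicit. Unset Printing Implicit Defensive.
Import Order.TTheory GRing.Theory Num.Theory.
Local Open Scope ring_scope.

Section Defs.
Variable F : finFieldType.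

(* Z = F[t] is {poly F}.
   R = F((t^-1)): Laurent series sum_{n <= N} c_n t^n, represented by the
   coefficient function c : int -> F, vanishing above some bound N. *)
Definition laurent := {c : int -> F | exists N : int, forall n : int, N < n -> c n = 0}.

Definition lcoef (a : laurent) (n : int) : F := proj1_sig a n.

Definition mulLP (a : laurent) (f : {poly F}) (n : int) : F :=
  \sum_(j < size f) lcoef a (n - (j : nat)%:Z) * f`_j.

(* a in Q = F(t)  iff  a = u / v with u, v in Z, v <> 0,
   i.e. v * a in Z, i.e. all coefficients of v * a at negative indices vanish *)
Definition in_Q (a : laurent) : Prop :=
  exists v : {poly F}, v != 0 /\ forall n : int, n < 0 -> mulLP a v n = 0.

Definition Peval (K : seq nat) (alpha : nat -> laurent) (u : {poly F}) (n : int) : F :=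
  \sum_(r <- 0%N :: K) mulLP (alpha r) (u ^+ r) n.

(* Membership of (x mod Z) in the cylinder set C(M; a_1..a_M): the representative
   sum_{n<=-1} c_n t^n of x mod Z has the same negative-index coefficients as x. *)
Definition in_cylinder (x : int -> F) (M : nat) (a : 'I_M -> F) : bool :=
  [forall i : 'I_M, x (- ((i : nat).+1)%:Z) == a i].

Definition rconverges (s : nat -> rat) (l : rat) : Prop :=
  forall eps : rat, 0 < eps -> exists N0 : nat, forall N : nat, (N0 <= N)%N -> `|s N - l| < eps.

Definition Folner (Fs : nat -> seq {poly F}) : Prop :=
  (forall N, uniq (Fs N) /\ Fs N != [::]) /\
  forall u : {poly F},
    rconverges (fun N => (count (fun x => (x - u) \in Fs N) (Fs N))%:R / (size (Fs N))%:R) 1.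
(* |F_N ∩ (F_N + u)| = #{x in F_N : x - u in F_N} *)

Definition unif_distributed (s : {poly F} -> int -> F) (Fs : nat -> seq {poly F}) : Prop :=
  forall (M : nat) (a : 'I_M -> F),
    rconverges (fun N => (count (fun u => in_cylinder (s u) a) (Fs N))%:R / (size (Fs N))%:R)
               (1 / (#|F| ^ M)%N%:R).

Definition well_distributed (s : {poly F} -> int -> F) : Prop :=
  forall Fs, Folner Fs -> unif_distributed s Fs.

End Defs.

(* Main.v *)
(* Characters of F_q^M turn well-distribution into decay of averages of
   chi(sum_r Phi_r(u^r)), with Phi_r : F_q[t] -> F_q^M additive.  Exponents differing by a
   power of p are merged (x |-> x^p is additive), so all r may be taken coprime to p; by (ii)
   the k-th functional is untouched.  Call Phi_r rational if chi o Phi_r is trivial on a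
   nonzero ideal; chi o Phi_k is not, as alpha_k is irrational.

   Van der Corput differencing uses steps in an ideal (w) on which all rational Phi_r are
   trivial, so only the irrational ones matter.  If d is the largest base-p digit sum among
   their exponents, d differences turn chi of the sum into a multiadditive form in the steps
   h_1, ..., h_d, built from the monomials prod_i h_i^(p^tau_i) with tau a rearrangement of
   the digits of r.  If the averages do not decay, this form is trivial for all h_1 in some
   finite-index subgroup, all h_2 in some finite-index subgroup depending on h_1, and so on.
   Multiplying the h_i by suitable powers of t and subtracting kills any one chosen monomial
   while keeping another: since r is coprime to p, 0 occurs in every tau, so distinct
   vectors (p^tau_i) are never proportional.  One monomial survives and exhibits an
   irrational Phi_r as rational. *)
Require Import Defs.
From mathcomp Require Import all_boot all_order all_fingroup all_algebra all_field all_character.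
From mathcomp Require Import boolp.
From mathcomp Require Import ring zify.
Import Order.TTheory GRing.Theory Num.Theory.
Local Open Scope ring_scope.
Set Implicit Arguments.
Unset Strict Implicit.
Unset Printing Implicit Defensive.

(** * Uniform averages and van der Corput's inequality *)

Section MeanZero.
Variables (C : archiClosedFieldType) (G : zmodType).
Implicit Types (g : G -> C) (H : seq G).

(* Since [H] is free, sumsets and translates of good sets are again available; the
   uniformity in [x] is what gives decay along every Folner sequence. *)
Definition mean_zero g := forall eps : C, 0 < eps ->
  exists2 H : seq G, H != [::] &
    forall x, `|\sum_(h <- H) g (x + h)| <= eps *+ size H.

Lemma sum_seq_const (T : Type) (s : seq T) (c : C) :
  \sum_(i <- s) c = c *+ size s.
Proof. by rewrite big_const_seq count_predT iter_addr_0. Qed.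

Lemma sum_sumset_le g H (eps : C) :
  (forall x, `|\sum_(h <- H) g (x + h)| <= eps *+ size H) ->
  forall H' x, `|\sum_(h' <- H') \sum_(h <- H) g (x + (h' + h))|
                <= eps *+ (size H' * size H).
Proof.
move=> gH H' x; apply: le_trans (ler_norm_sum _ _ _) _.
rewrite mulnC mulrnA -sum_seq_const; apply: ler_sum => h' _.
by under eq_bigr do rewrite addrA.
Qed.

(** A sumset inherits the bound of either summand, so finitely many functions can share one
    averaging set. *)
Lemma mean_zero_family (I : eqType) (s : seq I) (g : I -> G -> C) :
  (forall i, i \in s -> mean_zero (g i)) ->
  forall eps : C, 0 < eps -> exists2 H : seq G, H != [::] &
    forall i x, i \in s -> `|\sum_(h <- H) g i (x + h)| <= eps *+ size H.
Proof.
elim: s => [|i s IH] gs eps eps0; first by exists [:: 0].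
have [H1 H1n gH1] := gs i (mem_head _ _) _ eps0.
have [|H2 H2n gH2] := IH _ eps eps0.
  by move=> j js; apply: gs; rewrite inE js orbT.
exists [seq h1 + h2 | h1 <- H1, h2 <- H2].
  by rewrite -size_eq0 size_allpairs muln_eq0 !size_eq0 negb_or H1n.
move=> j x; rewrite inE size_allpairs big_allpairs_dep => /predU1P[->|js].
  rewrite exchange_big mulnC /=.
  under eq_bigr => h2 _ do under eq_bigr => h1 _ do rewrite (addrC h1).
  exact: sum_sumset_le.
by apply: sum_sumset_le => y; exact: gH2.
Qed.

Lemma sqr_norm_sum_le (K : numDomainType) (T : Type) (s : seq T) (z : T -> K) :
  `|\sum_(i <- s) z i| ^+ 2 <= (\sum_(i <- s) `|z i| ^+ 2) * (size s)%:R.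
Proof.
apply: le_trans (_ : (\sum_(i <- s) `|z i|) ^+ 2 <= _).
  by rewrite lerXn2r ?nnegrE ?ler_norm_sum ?sumr_ge0.
elim: s => [|i s IH] /=; first by rewrite !big_nil expr0n mul0r.
rewrite !big_cons.
have S0 : 0 <= \sum_(j <- s) `|z j| by apply: sumr_ge0.
have Q0 : 0 <= \sum_(j <- s) `|z j| ^+ 2 by apply: sumr_ge0 => j _; rewrite exprn_ge0.
move: (normr_ge0 (z i)) S0 Q0 IH; move: (`|z i|) (\sum_(j <- s) _) (\sum_(j <- s) _).
move=> a Q S a0 S0 Q0 IH.
have [n0|n0] := posnP (size s).
  move: IH; rewrite n0 mulr0 => S2.
  have : S ^+ 2 == 0 by rewrite eq_le S2 exprn_ge0.
  by rewrite expf_eq0 /= => /eqP S0'; rewrite S0' addr0 mulr1 lerDl.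
have {}n0 : 0 < (size s)%:R :> K by rewrite ltr0n.
rewrite -natr1; move: n0 IH; move: ((size s)%:R : K) => n n0 IH.
have h : 0 <= (S - a * n) ^+ 2.
  apply: real_exprn_even_ge0 => //.
  by rewrite rpredB // ger0_real // mulr_ge0 // ltW.
rewrite -(ler_pM2l n0) -subr_ge0.
have -> : n * ((a ^+ 2 + Q) * (n + 1)) - n * (a + S) ^+ 2 =
  (S - a * n) ^+ 2 + (Q * n - S ^+ 2) + n * (Q * n - S ^+ 2) by ring.
have QS : 0 <= Q * n - S ^+ 2 by rewrite subr_ge0.
have nQS : 0 <= n * (Q * n - S ^+ 2) by apply: mulr_ge0 => //; exact: ltW.
by apply: addr_ge0 => //; exact: addr_ge0.
Qed.

(** Average over the sumset of [H] and the points [h i]. After Cauchy-Schwarz over [H], the [n]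
    diagonal terms cost [size H] each and all others at most [eta *+ size H]. *)
Lemma van_der_corput g :
  (forall x, `|g x| = 1) ->
  (forall n, exists h : nat -> G, forall i j, (i < n)%N -> (j < n)%N -> i != j ->
      mean_zero (fun x => g (x + h i) * (g (x + h j))^*)) ->
  mean_zero g.
Proof.
move=> g1 hg eps eps0.
(* Once [1 <= eta *+ n], the factor [1 + eta * n] is at most [2 * eta * n], that is
   [eps ^+ 2 * n]. *)
pose eta : C := eps ^+ 2 / 2%:R.
have eta0 : 0 < eta by rewrite divr_gt0 ?exprn_gt0 ?ltr0n.
pose n := (Num.bound eta^-1).+1.
have n_eta : 1 <= eta *+ n.
  have : eta^-1 < (Num.bound eta^-1)%:R by apply: archi_boundP; rewrite invr_ge0 ltW.
  rewrite -(ltr_pM2l eta0) divff ?gt_eqF // => /ltW h.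
  rewrite -mulr_natr; apply: le_trans h _.
  by rewrite ler_pM2l // ler_nat leqnSn.
have n0 : (0 < n)%N by [].
move: n n_eta n0 => n n_eta n0; have [h hP] := hg n.
have [|H H0 HP] := @mean_zero_family _
  [seq ij <- [seq (i, j) | i <- iota 0 n, j <- iota 0 n] | ij.1 != ij.2]
  (fun ij x => g (x + h ij.1) * (g (x + h ij.2))^*) _ eta eta0.
  move=> [i j]; rewrite mem_filter /= => /andP[ij].
  case/allpairsP => -[i' j'] [] /=.
  by rewrite !mem_iota /= => i'n j'n [ei ej]; subst; exact: hP.
exists [seq h' + h i | h' <- H, i <- iota 0 n].
  by rewrite -size_eq0 size_allpairs size_iota muln_eq0 size_eq0 negb_or H0 -lt0n.
move=> x; rewrite size_allpairs big_allpairs_dep size_iota.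
have pos k : 0 <= eps *+ k by rewrite mulrn_wge0 // ltW.
rewrite -(@ler_pXn2r _ 2) ?nnegrE //.
apply: le_trans (sqr_norm_sum_le _ _) _.
set T := \sum_(h' <- H) _.
have TE : T = \sum_(i <- iota 0 n) \sum_(j <- iota 0 n)
    \sum_(h' <- H) g ((x + h') + h i) * (g ((x + h') + h j))^*.
  rewrite /T; under eq_bigr => h' _.
    rewrite normCK rmorph_sum mulr_suml.
    under eq_bigr => i _.
      rewrite mulr_sumr; under eq_bigr do rewrite !addrA; over.
    over.
  by rewrite exchange_big; apply: eq_bigr => i _; rewrite exchange_big.
have T0 : 0 <= T by apply: sumr_ge0 => h' _; rewrite exprn_ge0.
have HR : 0 <= (size H)%:R :> C by rewrite ler0n.
have TH : T <= n%:R * (size H)%:R * (1 + eta * n%:R).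
  rewrite -(ger0_norm T0) TE.
  apply: le_trans (_ : \sum_(i <- iota 0 n) ((size H)%:R + (eta *+ size H) *+ n) <= _).
    apply: le_trans (ler_norm_sum _ _ _) _.
    rewrite big_seq [X in _ <= X]big_seq; apply: ler_sum => i; rewrite mem_iota => /= iN.
    apply: le_trans (ler_norm_sum _ _ _) _.
    apply: le_trans (_ : \sum_(j <- iota 0 n)
      ((if j == i then (size H)%:R else 0) + eta *+ size H) <= _).
      rewrite big_seq [X in _ <= X]big_seq; apply: ler_sum => j; rewrite mem_iota => /= jN.
      case: eqVneq => [->|ji].
        apply: le_trans (ler_norm_sum _ _ _) _.
        under eq_bigr do rewrite normrM norm_conjC !g1 mulr1.
        by rewrite sum_seq_const lerDl mulrn_wge0 // ltW.
      rewrite add0r; apply: (HP (i, j)); rewrite mem_filter /= eq_sym ji /=.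
      by apply/allpairsP; exists (i, j); rewrite !mem_iota.
    rewrite big_split /= sum_seq_const size_iota lerD2r.
    rewrite -big_mkcond /= big_const_seq iter_addr_0.
    by rewrite -[count _ _]/(count_mem i _) count_uniq_mem ?iota_uniq // mem_iota /= iN.
  rewrite sum_seq_const size_iota -(mulr_natl (_ + _)) -(mulr_natr (_ *+ _)) -(mulr_natr eta).
  by rewrite le_eqVlt; apply/orP; left; apply/eqP; ring.
rewrite -(mulr_natr eps) natrM.
apply: le_trans (ler_wpM2r HR TH) _.
have -> : (eps * ((size H)%:R * n%:R)) ^+ 2 =
  n%:R * (size H)%:R * (eta * n%:R + eta * n%:R) * (size H)%:R.
  rewrite exprMn; have -> : eps ^+ 2 = eta + eta.
    by rewrite /eta -mulr2n -(mulr_natr (_ / _)) divfK // pnatr_eq0.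
  ring.
apply: ler_wpM2r => //; apply: ler_wpM2l; first by rewrite mulr_ge0 ?ler0n.
by rewrite lerD2r mulr_natr.
Qed.

Lemma mean_zero_shift g y : mean_zero g -> mean_zero (fun x => g (x + y)).
Proof.
move=> gP eps /gP[H H0 HP]; exists H => // x.
by under eq_bigr do rewrite addrAC.
Qed.

Lemma mean_zero_scale g (z : C) : `|z| = 1 -> mean_zero g -> mean_zero (fun x => z * g x).
Proof.
move=> z1 gP eps /gP[H H0 HP]; exists H => // x.
by rewrite -mulr_sumr normrM z1 mul1r.
Qed.

Lemma mean_zero_ext g g' : g =1 g' -> mean_zero g -> mean_zero g'.
Proof.
move=> e gP eps /gP[H H0 HP]; exists H => // x.
by under eq_bigr do rewrite -e.
Qed.

End MeanZero.
(** * Phases with a prescribed iterated difference *)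

Section Phase.
Variables (C : archiClosedFieldType) (R : idomainType) (V : zmodType) (chi : V -> C).
Hypothesis chiD : forall x y, chi (x + y) = chi x * chi y.
Hypothesis chi_norm : forall x, `|chi x| = 1.

Lemma chi_neq0 x : chi x != 0.
Proof. by rewrite -normr_gt0 chi_norm. Qed.

Lemma chi0 : chi 0 = 1.
Proof. by apply: (mulfI (chi_neq0 0)); rewrite -chiD addr0 mulr1. Qed.

Lemma chiB x y : chi (x - y) = chi x / chi y.
Proof. by apply: (mulIf (chi_neq0 y)); rewrite -chiD subrK divfK ?chi_neq0. Qed.

Lemma chi_conjM x y : chi x * (chi y)^* = chi (x - y).
Proof.
rewrite chiB; congr (_ * _); apply: (mulfI (chi_neq0 y)).
by rewrite -normCK chi_norm expr1n divff ?chi_neq0.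
Qed.

(* The colouring plays the role of the coset map: a subgroup is [large] iff it has
   finite index, and this form pulls back along additive maps with no choice of
   representatives. *)
Definition large (U : R -> Prop) :=
  exists (T : finType) (c : R -> T), forall x y, c x = c y -> U (x - y).

Lemma large_mono (U U' : R -> Prop) : (forall x, U x -> U' x) -> large U -> large U'.
Proof. by move=> UU' [T [c cP]]; exists T, c => x y /cP /UU'. Qed.

Lemma largeI (U U' : R -> Prop) : large U -> large U' -> large (fun x => U x /\ U' x).
Proof.
move=> [T [c cP]] [T' [c' cP']]; exists (T * T')%type, (fun x => (c x, c' x)).
by move=> x y [/cP ? /cP' ?].
Qed.

Lemma large_mulr (U : R -> Prop) g : large U -> large (fun x => U (g * x)).
Proof.
by move=> [T [c cP]]; exists T, (fun x => c (g * x)) => x y /cP; rewrite mulrBr.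
Qed.

(** Greedy choice: if no further point could be added, every [x] would differ from some chosen [h i]
    by an element of [U], and this index would be a colouring showing [U] large. *)
Lemma not_large_separated (U : R -> Prop) :
  (forall x y, U x -> U y -> U (x - y)) -> ~ large U ->
  forall n, exists h : nat -> R,
    forall i j, (i < n)%N -> (j < n)%N -> i != j -> ~ U (h i - h j).
Proof.
move=> Usub Ularge; elim=> [|n [h hP]]; first by exists (fun=> 0).
have UC x y : U (x - y) -> U (y - x).
  by move=> Uxy; rewrite -opprB -sub0r -(subrr (x - y)); apply: (Usub) => //; exact: Usub.
have [x xP] : exists x, forall i, (i < n)%N -> ~ U (x - h i).
  apply: contrapT => nx; apply: Ularge.
  have cov x : exists i : 'I_n, U (x - h i).
    apply: contrapT => ni; apply: nx; exists x => i iN Ui.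
    by apply: ni; exists (Ordinal iN).
  have [c cP] := choice cov.
  exists 'I_n, c => x y cxy.
  have -> : x - y = (x - h (c x)) - (y - h (c y)) by rewrite cxy opprB addrA subrK.
  exact: Usub.
exists (fun i => if (i < n)%N then h i else x) => i j.
rewrite !ltnS => iN jN ij.
case: ltnP => iN'; case: ltnP => jN'.
- exact: hP.
- by move=> /UC; apply: xP.
- exact: xP.
- move: ij; rewrite (_ : i = j) ?eqxx //.
  by apply/eqP; rewrite eqn_leq (leq_trans iN) // (leq_trans jN).
Qed.

(* [D] takes [d.+1] arguments. *)
Fixpoint degenerate d (D : seq R -> V) : Prop :=
  if d is d'.+1 then large (fun h => degenerate d' (fun hs => D (h :: hs)))
  else forall h, chi (D [:: h]) = 1.

Lemma degenerate_ext d D D' : (forall hs, size hs = d.+1 -> D hs = D' hs) ->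
  degenerate d D -> degenerate d D'.
Proof.
elim: d D D' => [|d IH] D D' DD' /=; first by move=> D1 h; rewrite -DD'.
apply: large_mono => h; apply: IH => hs hsd; apply: DD'.
by rewrite /= hsd.
Qed.

Lemma degenerateB d D D' : degenerate d D -> degenerate d D' ->
  degenerate d (fun hs => D hs - D' hs).
Proof.
elim: d D D' => [|d IH] D D' /=; first by move=> D1 D1' h; rewrite chiB D1 D1' divr1.
move=> D1 D1'; apply: large_mono (largeI D1 D1') => h [].
exact: IH.
Qed.

Definition scale (g : nat -> R) (hs : seq R) := mkseq (fun i => g i * hs`_i) (size hs).

Lemma scale_cons g h hs : scale g (h :: hs) = g 0%N * h :: scale (g \o succn) hs.
Proof.
by rewrite /scale /mkseq /= -[1%N]/(1 + 0)%N iotaDl -map_comp.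
Qed.

Lemma degenerate_scale d D g : degenerate d D -> degenerate d (D \o scale g).
Proof.
elim: d D g => [|d IH] D g /=.
  by move=> D1 h; rewrite scale_cons /scale /= D1.
move=> /(large_mulr (g 0%N)); apply: large_mono => h /(IH _ (g \o succn)).
by apply: degenerate_ext => hs _ /=; rewrite scale_cons.
Qed.

Fixpoint Diff (W : zmodType) (hs : seq R) (f : R -> W) : R -> W :=
  if hs is h :: hs' then Diff hs' (fun x => f (x + h) - f x) else f.

Definition slotwise_additive n (D : seq R -> V) := forall s x y s',
  (size s + size s').+1 = n -> D (s ++ (x - y) :: s') = D (s ++ x :: s') - D (s ++ y :: s').

(** Induction on [d], one van der Corput step at a time: the first-slot values giving a degenerate
    form are closed under differences but not large, so separated steps exist. Comparing only values
    of [chi] lets terms invisible to [chi] be left out of [D]. *)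
Lemma mean_zero_phase (p : nat) (w : R) d D (f : R -> V) :
  p \in [pchar R] -> slotwise_additive d.+1 D ->
  (forall hs x, size hs = d.+1 -> chi (Diff [seq w * h | h <- hs] f x) = chi (D hs)) ->
  ~ degenerate d D -> mean_zero (chi \o f).
Proof.
move=> pR; elim: d D f => [|d IH] D f Dadd fD /=.
  (* Some step multiplies the phase by [z != 1]; as [p] kills the step, [z ^+ p = 1], and the
     geometric sum over its multiples vanishes. *)
  move=> /existsNP[h hP].
  set z := chi (D [:: h]) in hP *.
  have fz x : chi (f (x + w * h)) = z * chi (f x).
    by rewrite /z -(fD _ x) //= chiB divfK ?chi_neq0.
  have fzn n x : chi (f (x + w * h *+ n)) = z ^+ n * chi (f x).
    elim: n => [|n IHn]; first by rewrite mulr0n addr0 expr0 mul1r.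
    by rewrite mulrSr addrA fz IHn exprS mulrA.
  have zp : z ^+ p = 1.
    apply: (mulIf (chi_neq0 (f 0))).
    by rewrite -fzn mul1r -mulr_natr (pcharf0 pR) mulr0 addr0.
  move=> eps eps0; exists [seq w * h *+ n | n <- iota 0 p].
    by rewrite -size_eq0 size_map size_iota -lt0n (prime_gt0 (pcharf_prime pR)).
  move=> x; rewrite big_map size_map size_iota.
  under eq_bigr do rewrite /= fzn.
  rewrite -mulr_suml.
  have -> : \sum_(n <- iota 0 p) z ^+ n = 0.
    have z1 : z - 1 != 0 by rewrite subr_eq0; apply/eqP.
    apply: (mulfI z1); rewrite mulr0.
    have := subrX1 z p; rewrite -(big_mkord xpredT (fun i => z ^+ i)) /index_iota subn0.
    by rewrite zp subrr.
  by rewrite mul0r normr0 mulrn_wge0 // ltW.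
move=> nlarge; apply: van_der_corput => [x|n]; first exact: chi_norm.
have [|h hP] := not_large_separated _ nlarge n.
  move=> x y Dx Dy; have := degenerateB Dx Dy.
  by apply: degenerate_ext => hs hsd; rewrite (Dadd [::]) ?hsd.
exists (fun i => w * h i) => i j iN jN ij.
(* Up to translation by [w * h j], the correlation is the phase of [f] differenced once, and its
   form has first slot [h i - h j]. *)
pose g := fun x => f (x + w * (h i - h j)) - f x.
apply: (@mean_zero_ext _ _ (fun x => chi (g (x + w * h j)))).
  by move=> x; rewrite /= chi_conjM /g; congr (chi (f _ - _)); ring.
apply: (@mean_zero_shift _ _ (chi \o g)).
apply: IH (hP i j iN jN ij) => [s x y s' sd|hs x hsd].
  by rewrite -!cat_cons Dadd //= addSn sd.
by rewrite -(fD _ x) /= ?hsd.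
Qed.
End Phase.
(** * Products of Frobenius powers *)

Section Monomials.
Variables (R : idomainType) (p : nat).
Hypothesis pR : p \in [pchar R].

Let p_pr : prime p := pcharf_prime pR.

Lemma expr_pX_additive a : zmod_morphism (fun x : R => x ^+ (p ^ a)).
Proof.
move=> x y; have pn : [pchar R].-nat (p ^ a)%N.
  by rewrite (eq_pnat _ (pcharf_eq pR)) pnatX pnat_id.
by rewrite (exprDn_pchar _ _ pn) (exprNn_pchar _ pn).
Qed.

Definition frob_prod (tau : seq nat) (g : nat -> R) : R :=
  \prod_(i < size tau) g i ^+ (p ^ nth 0%N tau i).

Definition mon (tau : seq nat) (hs : seq R) : R := frob_prod tau (fun i => hs`_i).

Lemma mon_cons a tau h hs : mon (a :: tau) (h :: hs) = h ^+ (p ^ a) * mon tau hs.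
Proof. by rewrite /mon /frob_prod big_ord_recl. Qed.

(** Monomials are eigenvectors of [scale g], so subtracting two scalings can cancel a chosen one. *)
Lemma mon_scale tau g hs : size hs = size tau ->
  mon tau (scale g hs) = frob_prod tau g * mon tau hs.
Proof.
move=> hst; rewrite /mon /frob_prod -big_split; apply: eq_bigr => i _ /=.
by rewrite nth_mkseq ?hst // exprMn.
Qed.

Lemma frob_prod_neq0 tau g : (forall i, g i != 0) -> frob_prod tau g != 0.
Proof. by move=> g0; apply/prodf_neq0 => i _; rewrite expf_neq0. Qed.

Lemma frob_prod_single tau c i : (i < size tau)%N ->
  frob_prod tau (fun j => if j == i then c else 1) = c ^+ (p ^ nth 0%N tau i).
Proof.
move=> it; rewrite /frob_prod (bigD1 (Ordinal it)) //= eqxx big1 ?mulr1 // => j.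
by rewrite -val_eqE /= => /negbTE ->; rewrite expr1n.
Qed.

(* With sigma_d and tau_d = 0 the last entries: if sigma_i - sigma_d = tau_i for all i,
   then sigma - sigma_d = tau, and 0 \in sigma forces sigma_d = 0.  So some i < d
   violates this, and t^(p^sigma_d) at i against t^(p^sigma_i) at d works. *)
Lemma separating_weights (t : R) d sigma tau :
  (forall m n, t ^+ m = t ^+ n -> m = n) ->
  size sigma = d.+1 -> size tau = d.+1 -> 0%N \in sigma -> nth 0%N tau d = 0%N ->
  sigma != tau ->
  exists g g' : nat -> R,
    frob_prod sigma g = frob_prod sigma g' /\ frob_prod tau g != frob_prod tau g'.
Proof.
move=> tP ss st s0 taud st_neq.
have [i id neq] : exists2 i, (i < d.+1)%N & nth 0%N sigma i != (nth 0%N tau i + nth 0%N sigma d)%N.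
  apply: contrapT => nex; case/negP: st_neq.
  have E i : (i < d.+1)%N -> nth 0%N sigma i = (nth 0%N tau i + nth 0%N sigma d)%N.
    by move=> id; apply/eqP; apply: contrapT => /negP ?; apply: nex; exists i.
  have sd0 : nth 0%N sigma d = 0%N.
    have := E (index 0%N sigma); rewrite nth_index // -ss index_mem s0 => /(_ isT).
    by case: (nth 0%N sigma d) => // m; rewrite addnS.
  apply/eqP; apply: (@eq_from_nth _ 0%N); first by rewrite ss.
  by move=> j; rewrite ss => /E; rewrite sd0 addn0.
exists (fun j => if j == i then t ^+ (p ^ nth 0%N sigma d) else 1).
exists (fun j => if j == d then t ^+ (p ^ nth 0%N sigma i) else 1).
rewrite !frob_prod_single ?ss ?st // -!exprM -!expnD taud addn0 addnC; split=> //.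
apply/eqP => /tP /eqP; rewrite eqn_exp2l ?prime_gt1 // addnC => /eqP E.
by rewrite E eqxx in neq.
Qed.

Definition rational (C : archiClosedFieldType) (V : zmodType) (chi : V -> C) (Psi : R -> V) :=
  exists2 w : R, w != 0 & forall x, chi (Psi (w * x)) = 1.

(** * Eliminating monomials from a degenerate form *)

Section Kill.
Variables (C : archiClosedFieldType) (V : zmodType) (chi : V -> C).
Hypothesis chiD : forall x y, chi (x + y) = chi x * chi y.
Hypothesis chi_norm : forall x, `|chi x| = 1.
Variable t : R.
Hypothesis tP : forall m n, t ^+ m = t ^+ n -> m = n.

(** Pigeonhole on the colours of the powers of [t], which are pairwise distinct. *)
Lemma large_nonzero (U : R -> Prop) : large U -> exists2 x, x != 0 & U x.
Proof.
move=> [T [c cP]].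
have /injectivePn[i [j ij cij]] : ~~ injectiveb (fun i : 'I_#|T|.+1 => c (t ^+ i)).
  apply/negP => /injectiveP /leq_card; by rewrite card_ord ltnn.
exists (t ^+ i - t ^+ j); last exact: cP.
by rewrite subr_eq0; apply: contra ij => /eqP /tP ?; apply/eqP/val_inj.
Qed.

(** Fix a nonzero step in every slot but the last and absorb its Frobenius power into [v]; the last
    slot has exponent [p ^ 0], so the argument of [Psi] ranges over a whole ideal. *)
Lemma rational_of_degenerate_mon d tau v (Psi : R -> V) :
  size tau = d.+1 -> nth 0%N tau d = 0%N -> v != 0 ->
  degenerate chi d (fun hs => Psi (v * mon tau hs)) -> rational chi Psi.
Proof.
elim: d tau v => [|d IH] [//|a tau] v /=.
  move=> [/size0nil ->] /= -> v0 deg; exists v => // x.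
  by rewrite -(deg x) mon_cons /mon /frob_prod big_ord0 mulr1 expn0 expr1.
move=> [st] taud v0 /large_nonzero[h h0 deg].
apply: (IH tau (v * h ^+ (p ^ a))) => //; first by rewrite mulf_neq0 ?expf_neq0.
by apply: degenerate_ext deg => hs _; rewrite mon_cons mulrA.
Qed.

(** Induction on [s]: subtract two scalings that agree on [sigma j] but not on [tau]. The [j]-th
    term disappears, the other terms acquire a constant inside [Theta], and [Psi] is precomposed
    with a nonzero multiplication. *)
Lemma rational_of_degenerate_sum (I : eqType) (s : seq I) d tau (Psi : R -> V)
    (sigma : I -> seq nat) (Theta : I -> R -> V) :
  size tau = d.+1 -> nth 0%N tau d = 0%N -> zmod_morphism Psi ->
  (forall i, i \in s -> [/\ size (sigma i) = d.+1, 0%N \in sigma i & sigma i != tau]) ->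
  (forall i, zmod_morphism (Theta i)) ->
  degenerate chi d
    (fun hs => Psi (mon tau hs) + \sum_(i <- s) Theta i (mon (sigma i) hs)) ->
  rational chi Psi.
Proof.
move=> st taud; elim: s Psi Theta => [|j s IH] Psi Theta PsiB sP ThetaB deg.
  apply: (@rational_of_degenerate_mon d tau 1) => //; first exact: oner_neq0.
  by apply: degenerate_ext deg => hs _; rewrite big_nil addr0 mul1r.
have [sj s0 sneq] := sP j (mem_head _ _).
have [g [g' [gE gN]]] := separating_weights tP sj st s0 taud sneq.
pose del rho := frob_prod rho g - frob_prod rho g'.
have [||||w w0 wP] := IH (fun x => Psi (del tau * x)) (fun i x => Theta i (del (sigma i) * x)).
- by move=> x y /=; rewrite mulrBr PsiB.
- by move=> i si; apply: sP; rewrite inE si orbT.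
- by move=> i x y /=; rewrite mulrBr ThetaB.
- have := degenerateB chiD chi_norm (degenerate_scale g deg) (degenerate_scale g' deg).
  apply: degenerate_ext => hs hsd /=; rewrite !big_cons !mon_scale ?hsd ?st ?sj // gE.
  rewrite opprD addrACA -PsiB -mulrBl; congr (_ + _).
  rewrite opprD addrACA subrr add0r -sumrB; apply: eq_big_seq => i si.
  have [ssi _ _] : [/\ size (sigma i) = d.+1, 0%N \in sigma i & sigma i != tau].
    by apply: sP; rewrite inE si orbT.
  by rewrite !mon_scale ?hsd ?ssi // -ThetaB -mulrBl.
exists (del tau * w); first by rewrite mulf_neq0 // subr_eq0.
by move=> x; rewrite -mulrA.
Qed.
End Kill.

(** * Rearrangements of digit lists *)

Definition ins (a : nat) (tau : seq nat) i := take i tau ++ a :: drop i tau.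
Definition del (T : Type) i (s : seq T) := take i s ++ drop i.+1 s.

Lemma insS a b tau i : ins a (b :: tau) i.+1 = b :: ins a tau i.
Proof. by []. Qed.

Lemma delS (T : Type) i h (s : seq T) : del i.+1 (h :: s) = h :: del i s.
Proof. by []. Qed.

(* The rearrangements of [e], with multiplicity. *)
Fixpoint shuffles (e : seq nat) : seq (seq nat) :=
  if e is a :: e' then [seq ins a tau i | tau <- shuffles e', i <- iota 0 (size e)]
  else [:: [::]].

Lemma perm_ins a tau i : perm_eq (ins a tau i) (a :: tau).
Proof. by rewrite /ins perm_catC /= -cat_cons perm_catC -(cat1s a) perm_catCA cat_take_drop. Qed.

Lemma perm_shuffles e tau : tau \in shuffles e -> perm_eq tau e.
Proof.
elim: e tau => [|a e IH] tau; first by rewrite inE => /eqP ->.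
case/allpairsPdep => s [i [/IH se _ ->]].
by rewrite (permPl (perm_ins _ _ _)) perm_cons.
Qed.

Lemma mon_ins a tau i hs : (i <= size tau)%N -> size hs = (size tau).+1 ->
  mon (ins a tau i) hs = hs`_i ^+ (p ^ a) * mon tau (del i hs).
Proof.
elim: i tau hs => [|i IH] [|b tau] [|h hs] //= it [hst].
- by rewrite /ins /del /= drop0 mon_cons.
- by rewrite /ins /del /= drop0 mon_cons.
by rewrite insS mon_cons IH // delS mon_cons mulrCA.
Qed.

Lemma eq_ins a tau i tau0 : (i <= size tau)%N -> size tau0 = (size tau).+1 ->
  (ins a tau i == tau0) = (nth 0%N tau0 i == a) && (tau == del i tau0).
Proof.
elim: i tau tau0 => [|i IH] [|b tau] [|c tau0] //= it [st].
- by rewrite /ins /del /= drop0 eqseq_cons eq_sym.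
- by rewrite /ins /del /= drop0 eqseq_cons eq_sym.
rewrite insS eqseq_cons IH // delS.
by rewrite eqseq_cons andbCA.
Qed.

(* The multiplicity is the product of the factorials of the digits, a unit mod p. *)
Lemma count_shuffles e : (forall a, count_mem a e < p)%N ->
  exists2 c, ~~ (p %| c)%N & forall tau, perm_eq tau e -> count_mem tau (shuffles e) = c.
Proof.
elim: e => [|a e IH] eP.
  exists 1%N; first by rewrite gtnNdvd // prime_gt1.
  by move=> tau /perm_nilP ->.
have [|c pc cP] := IH.
  by move=> b; apply: leq_ltn_trans (eP b); rewrite /= leq_addl.
exists (count_mem a (a :: e) * c)%N.
  rewrite Euclid_dvdM // negb_or pc andbT gtnNdvd //.
  by rewrite /= eqxx.
move=> tau0 tau0e.
have st0 := perm_size tau0e.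
rewrite -sum1_count big_mkcond big_allpairs_dep.
(* Sort by the position of the inserted [a]: only positions where [tau0] has entry [a] contribute,
   each through the copies of [del i tau0]. *)
have -> : (\sum_(tau <- shuffles e) \sum_(i <- iota 0 (size (a :: e)))
    (if ins a tau i == tau0 then 1 else 0) =
  \sum_(tau <- shuffles e) \sum_(i <- iota 0 (size (a :: e)))
    (if nth 0 tau0 i == a then if tau == del i tau0 then 1 else 0 else 0))%N.
  apply: eq_big_seq => tau /perm_shuffles /perm_size st.
  apply: eq_big_seq => i; rewrite mem_iota /= ltnS => ie.
  by rewrite eq_ins ?st //; case: eqP => //=.
rewrite exchange_big -(seq.permP tau0e) -sum1_count [in RHS](big_nth 0%N) big_distrl /=.
rewrite st0 /index_iota subn0 [RHS]big_mkcond -[0%N :: iota 1 _]/(iota 0 (size (a :: e))).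
apply: eq_big_seq => i.
rewrite mem_iota => /= ie; case: eqP => [tia|]; last by rewrite big1.
rewrite mul1n -big_mkcond /= sum1_count cP //.
have : perm_eq tau0 (a :: del i tau0).
  rewrite -{1}(cat_take_drop i tau0) (drop_nth 0%N) ?st0 // tia /del.
  by rewrite -cat1s -[a :: (_ ++ _)]cat1s perm_catCA.
by rewrite (permPl tau0e) perm_cons perm_sym.
Qed.

(** * Iterated differences of Frobenius monomials *)

Definition vanishes_from n (P : R -> R) := forall hs x, size hs = n -> Diff hs P x = 0.

Lemma Diff_ext (W : zmodType) hs (P Q : R -> W) x : P =1 Q -> Diff hs P x = Diff hs Q x.
Proof. by elim: hs P Q => [|h hs IH] P Q e //=; apply: IH => y; rewrite !e. Qed.

Lemma DiffD (W : zmodType) hs (P Q : R -> W) x :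
  Diff hs (fun u => P u + Q u) x = Diff hs P x + Diff hs Q x.
Proof.
elim: hs P Q => [|h hs IH] P Q //=.
by rewrite -IH; apply: Diff_ext => y; rewrite opprD addrACA.
Qed.

Lemma Diff0 (W : zmodType) hs x : Diff hs (fun _ : R => 0 : W) x = 0.
Proof. by elim: hs => //= h hs IH; rewrite -[RHS]IH; apply: Diff_ext => y; rewrite subrr. Qed.

Lemma Diff_sum (W : zmodType) (I : Type) (s : seq I) hs (P : I -> R -> W) x :
  Diff hs (fun u => \sum_(i <- s) P i u) x = \sum_(i <- s) Diff hs (P i) x.
Proof.
elim: s => [|i s IH].
  by rewrite big_nil -[RHS](Diff0 W hs x); apply: Diff_ext => y; rewrite big_nil.
by rewrite big_cons -IH -DiffD; apply: Diff_ext => y; rewrite big_cons.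
Qed.

Lemma Diff_comp (W W' : zmodType) hs (Phi : W -> W') (P : R -> W) x :
  zmod_morphism Phi -> Diff hs (Phi \o P) x = Phi (Diff hs P x).
Proof.
move=> PhiB; elim: hs P => [|h hs IH] P //=.
by rewrite -IH; apply: Diff_ext => y /=; rewrite PhiB.
Qed.

Lemma Diff_shift (W : zmodType) hs (P : R -> W) y x :
  Diff hs (fun u => P (u + y)) x = Diff hs P (x + y).
Proof.
elim: hs P => [|h hs IH] P //=.
by rewrite -IH; apply: Diff_ext => u; rewrite addrAC.
Qed.

(** Differencing commutes with translation, so the first step may equally be taken last. *)
Lemma Diff_cons (W : zmodType) h hs (P : R -> W) x :
  Diff (h :: hs) P x = Diff hs P (x + h) - Diff hs P x.
Proof.
rewrite /= DiffD Diff_shift; congr (_ + _).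
by rewrite (@Diff_comp W W _ -%R P) // => y z; rewrite opprB addrC opprK.
Qed.

Lemma vanishes_fromS n P : vanishes_from n P -> vanishes_from n.+1 P.
Proof. by move=> P0 [//|h hs] x [hsn]; rewrite Diff_cons !P0 // subrr. Qed.

(** Leibniz rule: exactly one step falls on [lam], because all steps together annihilate [P] while
    [lam], being additive, has constant first differences. *)
Lemma Diff_mul_additive (lam : R -> R) hs P x :
  zmod_morphism lam -> vanishes_from (size hs) P ->
  Diff hs (fun u => lam u * P u) x = \sum_(i < size hs) lam hs`_i * Diff (del i hs) P x.
Proof.
move=> lamB; elim: hs P => [|h hs IH] P P0.
  by rewrite big_ord0 /=; have := P0 [::] x (erefl _) => /= ->; rewrite mulr0.
rewrite big_ord_recl /=.
have lamD y : lam (y + h) = lam y + lam h.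
  by apply: (addIr (- lam h)); rewrite -lamB !addrK.
rewrite (@Diff_ext _ _ _ (fun u => lam u * (P (u + h) - P u) + lam h * P (u + h))); last first.
  by move=> y; rewrite lamD; ring.
rewrite DiffD addrC; congr (_ + _).
  rewrite /del /= drop0.
  rewrite (@Diff_comp R R _ (fun y => lam h * y) (fun u => P (u + h))); last first.
    by move=> y z; rewrite mulrBr.
  rewrite Diff_shift; congr (_ * _).
  (* One order below vanishing, the difference no longer depends on the base point. *)
  by apply/eqP; rewrite -subr_eq0 -Diff_cons P0.
by rewrite IH // => hs' y hs'n; apply: (P0 (h :: hs')); rewrite /= hs'n.
Qed.

Definition frob_mon (e : seq nat) (u : R) := \prod_(a <- e) u ^+ (p ^ a).

Lemma frob_mon_cons a e : frob_mon (a :: e) =1 fun u => u ^+ (p ^ a) * frob_mon e u.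
Proof. by move=> u; rewrite /frob_mon big_cons. Qed.

Lemma size_del (T : Type) i (s : seq T) : (i < size s)%N -> size (del i s) = (size s).-1.
Proof. by move=> si; rewrite size_cat size_take size_drop si; lia. Qed.

Lemma frob_mon_vanishes e n : (size e < n)%N -> vanishes_from n (frob_mon e).
Proof.
move=> /subnK <-; elim: (n - _)%N => [|k]; last exact: vanishes_fromS.
rewrite add0n; elim: e => [|a e IH].
  by move=> [//|h [|//]] x _; rewrite /= /frob_mon !big_nil subrr.
move=> hs x hsn; rewrite (Diff_ext _ _ (frob_mon_cons a e)) Diff_mul_additive.
- rewrite big1 // => i _; rewrite IH ?mulr0 // size_del //.
  by rewrite hsn.
- exact: expr_pX_additive.
- by rewrite hsn; apply: vanishes_fromS.
Qed.

(** Polarization: the factors are distributed over the steps, one each. Choosing the slot that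
    receives the head factor matches the recursion of [shuffles]. *)
Lemma Diff_frob_mon e hs x : size hs = size e ->
  Diff hs (frob_mon e) x = \sum_(tau <- shuffles e) mon tau hs.
Proof.
elim: e hs x => [|a e IH] hs x hse.
  by case: hs hse => // _; rewrite big_seq1 /= /frob_mon /mon /frob_prod big_nil big_ord0.
rewrite (Diff_ext _ _ (frob_mon_cons a e)) Diff_mul_additive; first last.
- by rewrite hse; apply: frob_mon_vanishes.
- exact: expr_pX_additive.
rewrite big_allpairs_dep -hse.
rewrite -(big_mkord xpredT (fun i => hs`_i ^+ (p ^ a) * Diff (del i hs) (frob_mon e) x)).
rewrite /index_iota subn0 exchange_big /=; apply: eq_big_seq => i.
rewrite mem_iota => /= ihs.
have sd : size (del i hs) = size e by rewrite size_del // hse.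
rewrite IH // mulr_sumr -/(shuffles e).
apply: eq_big_seq => tau /perm_shuffles /perm_size st.
rewrite mon_ins ?st //.
by rewrite -ltnS -[X in (_ < X)%N]/(size (a :: e)) -hse.
Qed.

(** Each base-[p] position is repeated as often as its digit, so [size e] is the digit sum of
    [r]. *)
Lemma digits_exist r : exists e : seq nat,
  (\sum_(a <- e) p ^ a = r)%N /\ forall a, (count_mem a e < p)%N.
Proof.
have p1 := prime_gt1 p_pr; have p0 := prime_gt0 p_pr.
elim/ltn_ind: r => r IH; case: (posnP r) => [->|r0].
  by exists [::]; split; [rewrite big_nil|].
have [e [eS eC]] := IH _ (ltn_Pdiv p1 r0).
(* The last digit gives copies of the exponent 0; the positions for the quotient by [p] move up by
   one. *)
exists (nseq (r %% p) 0%N ++ map succn e); split.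
  rewrite big_cat big_map big_nseq iter_addn_0 mul1n [RHS](divn_eq r p) addnC -eS big_distrl /=.
  by congr (_ + _)%N; apply: eq_bigr => a _; rewrite expnSr.
move=> a; rewrite count_cat count_map count_nseq /=.
case: a => [|a]; rewrite ?mul1n ?mul0n.
  rewrite (@eq_count _ _ pred0) ?count_pred0 ?addn0 ?ltn_mod //.
by rewrite add0n (@eq_count _ _ (pred1 a)) //.
Qed.
End Monomials.
(** * Sums of powers *)

Section PowerSums.
Variables (R : idomainType) (p : nat) (t : R).
Hypothesis pR : p \in [pchar R].
Hypothesis tP : forall m n, t ^+ m = t ^+ n -> m = n.
Variables (C : archiClosedFieldType) (V : zmodType) (chi : V -> C).
Hypothesis chiD : forall x y, chi (x + y) = chi x * chi y.
Hypothesis chi_norm : forall x, `|chi x| = 1.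

Let p_pr : prime p := pcharf_prime pR.

Lemma chi_sum (I : Type) (s : seq I) (F : I -> V) :
  chi (\sum_(i <- s) F i) = \prod_(i <- s) chi (F i).
Proof. by apply: big_morph; [exact: chiD | exact: chi0 chiD chi_norm]. Qed.

(** Every difference becomes a quotient of equal values under [chi]; this removes the rational
    terms. *)
Lemma chi_Diff_periodic w (F : R -> V) hs x :
  (forall x h, chi (F (x + w * h)) = chi (F x)) -> hs != [::] ->
  chi (Diff [seq w * h | h <- hs] F x) = 1.
Proof.
move=> Fper; elim: hs x => //= h [|h' hs] IH x _.
  by rewrite /= (chiB chiD chi_norm) Fper divff ?(chi_neq0 chi_norm).
have := Diff_cons (w * h) [seq w * h | h <- h' :: hs] F x.
by rewrite /= => ->; rewrite (chiB chiD chi_norm) !IH // divr1.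
Qed.

Lemma mon_slotwise tau (s s' : seq R) x y : (size s + size s').+1 = size tau ->
  mon p tau (s ++ (x - y) :: s') = mon p tau (s ++ x :: s') - mon p tau (s ++ y :: s').
Proof.
elim: s tau => [|h s IH] [|a tau] //= [sz]; rewrite !mon_cons.
  by rewrite (expr_pX_additive pR) mulrBl.
by rewrite IH // mulrBr.
Qed.

(** If all exponents were positive, [p] would divide the whole sum. *)
Lemma mem0_digits r e : ~~ (p %| r)%N -> (\sum_(a <- e) p ^ a = r)%N -> 0%N \in e.
Proof.
move=> pr er; apply: contraNT pr => e0; rewrite -er big_seq.
apply: (big_ind (fun n => p %| n)%N) => // [m n|[|a] ae]; first exact: dvdn_add.
  by rewrite ae in e0.
by rewrite expnS dvdn_mulr.
Qed.

Lemma zmod_morphism0 (U W : zmodType) (Phi : U -> W) : zmod_morphism Phi -> Phi 0 = 0.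
Proof. by move=> PhiB; rewrite -(subrr 0) PhiB subrr. Qed.

Lemma zmod_morphismD (U W : zmodType) (Phi : U -> W) x y :
  zmod_morphism Phi -> Phi (x + y) = Phi x + Phi y.
Proof. by move=> PhiB; apply: (addIr (- Phi y)); rewrite -PhiB !addrK. Qed.

Lemma zmod_morphism_sum (U W : zmodType) (Phi : U -> W) (I : Type) (s : seq I) (F : I -> U) :
  zmod_morphism Phi -> Phi (\sum_(i <- s) F i) = \sum_(i <- s) Phi (F i).
Proof.
by move=> PhiB; apply: big_morph => [x y|]; [exact: zmod_morphismD|exact: zmod_morphism0].
Qed.

Lemma zmod_morphismMn (U W : zmodType) (Phi : U -> W) x n :
  zmod_morphism Phi -> Phi (x *+ n) = Phi x *+ n.
Proof.
move=> PhiB; elim: n => [|n IH]; first by rewrite !mulr0n zmod_morphism0.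
by rewrite !mulrS zmod_morphismD // IH.
Qed.

Lemma seq_argmax (s : seq nat) (P : pred nat) (f : nat -> nat) k : k \in s -> P k ->
  exists m, [/\ m \in s, P m & forall r, r \in s -> P r -> (f r <= f m)%N].
Proof.
move=> ks Pk.
have ex : exists n, has (fun r => P r && (f r == n)) s.
  by exists (f k); apply/hasP; exists k => //; rewrite Pk /=.
have bd n : has (fun r => P r && (f r == n)) s -> (n <= \max_(r <- s) f r)%N.
  by case/hasP => r rs /andP[_ /eqP <-]; exact: leq_bigmax_seq.
case: (ex_maxnP ex bd) => n /hasP[m ms /andP[Pm /eqP fm]] nmax.
exists m; split=> // r rs Pr; rewrite fm; apply: nmax.
by apply/hasP; exists r => //; rewrite Pr /=.
Qed.

(** The irrationality of [Phi k] supplies an irrational exponent; the contradiction is reached at an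
    irrational [k'] of largest digit sum, which may differ from [k]. *)
Theorem mean_zero_power_sum (s : seq nat) (Phi : nat -> R -> V) k :
  uniq s -> (forall r, r \in s -> ~~ (p %| r)%N) -> (forall r, zmod_morphism (Phi r)) ->
  k \in s -> ~ rational chi (Phi k) ->
  mean_zero (fun u => chi (\sum_(r <- s) Phi r (u ^+ r))).
Proof.
move=> su sp PhiB ks kirr.
have [dg dgP] := choice (digits_exist pR).
pose irr r := `[< ~ rational chi (Phi r) >].
have [k' [k's /asboolP k'irr k'max]] :=
  @seq_argmax s irr (size \o dg) k ks (introT (asboolP _) kirr).
have [d dE] : exists d, size (dg k') = d.+1.
  have := mem0_digits (sp _ k's) (dgP k').1.
  by case: (dg k') => // a e _; exists (size e).
(* The common step modulus [w] will be the product of these [W r], with the default 1 at irrational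
   exponents. *)
have exW r : exists W, W != 0 /\ (~~ irr r -> forall x, chi (Phi r (W * x)) = 1).
  case: (boolP (irr r)) => [_|/asboolP/contrapT[w w0 wP]]; last by exists w.
  by exists 1; rewrite oner_neq0.
have [W WP] := choice exW.
pose w := \prod_(r <- s) W r.
have w0 : w != 0 by rewrite prodf_seq_neq0; apply/allP => r _ /=; exact: (WP r).1.
have wP r x : r \in s -> ~~ irr r -> chi (Phi r (w * x)) = 1.
  by move=> rs ri; rewrite /w (big_rem r) //= -mulrA (WP r).2.
pose top r := irr r && (size (dg r) == d.+1).
(* Among the irrational terms, those of smaller digit sum are annihilated by [d.+1] differences;
   rational terms are invisible to [chi] on steps in the ideal of [w]. *)
pose D hs := \sum_(r <- s | top r)
   Phi r (\sum_(tau <- shuffles (dg r)) mon p tau [seq w * h | h <- hs]).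
have powE r (u : R) : u ^+ r = frob_mon p (dg r) u.
  by rewrite -{1}(dgP r).1 /frob_mon -expr_sum.
apply: (@mean_zero_phase _ _ _ _ chiD chi_norm p w d D _ pR).
- move=> h x y h' hd; rewrite /D -sumrB; apply: eq_bigr => r /andP[_ /eqP dr].
  rewrite -PhiB -sumrB !map_cat /= mulrBr; congr (Phi r _).
  apply: eq_big_seq => tau /perm_shuffles /perm_size st.
  by rewrite mon_slotwise // !size_map st dr.
- move=> hs x hsd.
  rewrite Diff_sum /D chi_sum [in RHS]big_mkcond chi_sum.
  apply: eq_big_seq => r rs; case: ifP => [/andP[ri /eqP dr]|].
    rewrite -(Diff_frob_mon pR (e := dg r) x) ?size_map ?dr // -(@Diff_comp R R V _ (Phi r)) //.
    by congr (chi _); apply: Diff_ext => u /=; rewrite powE.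
  rewrite (chi0 chiD chi_norm) /top => /negbT.
  have [ri /= dr|ri _] := boolP (irr r); last first.
    apply: chi_Diff_periodic; last by case: (hs) hsd.
    move=> y h; rewrite -[LHS]mulr1.
    (* The factor 1 is written as [chi] at minus the difference of two [r]-th powers, a multiple of
       [w] by its factorization. *)
    rewrite -(wP r (- (h * \sum_(i < r) (y + w * h) ^+ (r.-1 - i) * y ^+ i)) rs ri) -chiD.
    congr (chi _); rewrite -zmod_morphismD //; congr (Phi r _).
    have := subrXX (y + w * h) y r; rewrite [_ - y]addrAC subrr add0r => E.
    by rewrite mulrN mulrA -E opprB addrC subrK.
  rewrite (@Diff_ext _ _ _ _ (Phi r \o frob_mon p (dg r))); last by move=> u /=; rewrite powE.
  rewrite Diff_comp // (frob_mon_vanishes pR (n := d.+1)) ?size_map //.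
    by rewrite zmod_morphism0 // (chi0 chiD chi_norm).
  by rewrite ltn_neqAle dr -dE; exact: k'max.
- move=> deg; apply: (k'irr).
  (* A digit 0 in last place makes the last slot enter linearly, as needed to extract an ideal. *)
  pose tau0 := rcons (rem 0%N (dg k')) 0%N.
  have d0 := mem0_digits (sp _ k's) (dgP k').1.
  have ptau0 : perm_eq tau0 (dg k').
    by rewrite (permPr (perm_to_rem d0)) perm_rcons.
  have [c pc cP] := count_shuffles pR (dgP k').2.
  pose L tau := frob_prod p tau (fun=> w).
  have L0 tau : L tau != 0 by apply: frob_prod_neq0.
  have monL tau hs : size hs = size tau -> mon p tau [seq w * h | h <- hs] = L tau * mon p tau hs.
    move=> st; rewrite -mon_scale //; congr (mon _ _ _).
    apply: (@eq_from_nth _ 0); first by rewrite size_map size_mkseq.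
    by move=> i; rewrite size_map => ih; rewrite (nth_map 0) // nth_mkseq.
  pose all := [seq (r, tau) | r <- [seq r <- s | top r], tau <- shuffles (dg r)].
  have allP i : i \in all -> [/\ i.1 \in s, top i.1 & perm_eq i.2 (dg i.1)].
    case/allpairsPdep => r [tau [rs /perm_shuffles ptau ->]] /=.
    by move: rs; rewrite mem_filter => /andP[].
  have [w1 w10 w1P] : rational chi (fun x => Phi k' (c%:R * L tau0 * x)).
    apply: (@rational_of_degenerate_sum R p pR C V chi chiD chi_norm t tP _
      [seq i <- all | i.2 != tau0] d tau0 _ snd (fun i x => Phi i.1 (L i.2 * x))).
    + by rewrite (perm_size ptau0) dE.
    + have : size (rem 0%N (dg k')) = d by rewrite size_rem // dE.
      by move=> sd; rewrite nth_rcons sd ltnn eqxx.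
    + by move=> x y /=; rewrite -PhiB -mulrBr.
    + move=> [r tau]; rewrite mem_filter => /andP[tn /allP[/= rs /andP[_ /eqP dr] ptau]].
      split=> //; first by rewrite (perm_size ptau).
      by rewrite (perm_mem ptau) (mem0_digits (sp _ rs) (dgP r).1).
    + by move=> i x y /=; rewrite -PhiB -mulrBr.
    apply: degenerate_ext deg => hs hsd.
    transitivity (\sum_(i <- all) Phi i.1 (L i.2 * mon p i.2 hs)).
      rewrite /D /all big_allpairs_dep big_filter; apply: eq_bigr => r /andP[_ /eqP dr].
      rewrite zmod_morphism_sum //; apply: eq_big_seq => tau /perm_shuffles /perm_size st.
      by rewrite monL // hsd st dr.
    rewrite (bigID (fun i => i.2 == tau0)) /= [in RHS]big_filter; congr (_ + _).
    rewrite big_mkcond big_allpairs_dep big_filter big_mkcond /=.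
    (* A rearrangement determines the digits and hence the exponent, so [tau0] occurs only for
       [r = k'], and there [c] times. *)
    transitivity (\sum_(r <- s) if r == k' then Phi k' (L tau0 * mon p tau0 hs) *+ c else 0).
      apply: eq_big_seq => r rs; case: eqVneq => [->|rk].
        have -> : top k' by rewrite /top dE eqxx andbT; exact/asboolP.
        rewrite -(big_mkcond (fun tau => tau == tau0)).
        rewrite (eq_bigr (fun=> Phi k' (L tau0 * mon p tau0 hs))).
          by rewrite big_const_seq iter_addr_0 -(cP _ ptau0).
        by move=> tau /eqP ->.
      case: ifP => // _; rewrite big1_seq // => tau /= taur; case: eqP => // E.
      case/eqP: rk; rewrite -(dgP r).1 -(dgP k').1; apply: perm_big.
      by rewrite perm_sym -(permPl ptau0) -E; exact: perm_shuffles.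
    rewrite (bigD1_seq k') //= eqxx big1 ?addr0; last by move=> r /negbTE ->.
    by rewrite -mulrA mulr_natl zmod_morphismMn.
  (* The image of [c] in [R] is nonzero because [p] does not divide [c]. *)
  exists (c%:R * L tau0 * w1); last by move=> x; rewrite -mulrA.
  rewrite !mulf_neq0 // -(dvdn_pcharf pR) //.
Qed.
End PowerSums.
(** * Folner averages, characters and fractional parts *)

Section FolnerAverages.
Variable F : finFieldType.

(** Replace the sum by the average of its translates over [H], where the mean-zero bound applies at
    each [u]. A translation alters the sum only outside the overlap of the two sets, by at most
    [eps / 4] of the size on either side. *)
Lemma folner_average (g : {poly F} -> algC) (Fs : nat -> seq {poly F}) :
  (forall u, `|g u| = 1) -> mean_zero g -> Folner Fs ->
  forall eps : algC, 0 < eps -> exists N0, forall N, (N0 <= N)%N ->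
    `|\sum_(u <- Fs N) g u| <= eps * (size (Fs N))%:R.
Proof.
move=> g1 gmz [Fsn Fslim] eps eps0.
have eps2 : 0 < eps / 2 by rewrite divr_gt0 // ltr0n.
have [H H0 HP] := gmz _ eps2.
have eps4 : 0 < eps / 4 by rewrite divr_gt0 // ltr0n.
pose n := Num.bound (eps / 4)^-1.
(* The Folner condition takes rational tolerances, so a rational one not exceeding [eps / 4] is
   chosen. *)
pose q : rat := n.+1%:R^-1.
have q0 : 0 < q by rewrite invr_gt0 ltr0n.
have qE : ratr q <= eps / 4.
  rewrite /q fmorphV rmorph_nat -[leRHS]invrK lef_pV2 ?posrE ?invr_gt0 ?ltr0n //.
  apply/ltW/(lt_trans (archi_boundP _)); first by rewrite invr_ge0 ltW.
  by rewrite ltr_nat.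
have exN h : exists N0, forall N, (N0 <= N)%N ->
    `|(count (fun x => x - h \in Fs N) (Fs N))%:R / (size (Fs N))%:R - 1| < q.
  exact: Fslim.
have [Nh NhP] := choice exN.
exists (\max_(h <- H) Nh h)%N => N NN.
have [Fu Fn0] := Fsn N.
have sF : 0 < (size (Fs N))%:R :> algC by rewrite ltr0n lt0n size_eq0.
have shift h : h \in H ->
    `|\sum_(u <- Fs N) g u - \sum_(u <- Fs N) g (u + h)| <= eps / 2 * (size (Fs N))%:R.
  move=> hH; have := NhP h N (leq_trans (leq_bigmax_seq _ hH isT) NN).
  set A := Fs N in Fu sF *; set c := count _ _ => cP.
  pose B := [seq u + h | u <- A].
  have Bu : uniq B by rewrite map_inj_uniq //; exact: addIr.
  have AB v : (v \in B) = (v - h \in A).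
    apply/mapP/idP => [[u uA ->]|vA]; first by rewrite addrK.
    by exists (v - h); rewrite ?subrK.
  have cE : c = count (mem B) A by apply: eq_count => v; rewrite /= AB.
  have cap : perm_eq [seq v <- A | v \in B] [seq v <- B | v \in A].
    by apply: uniq_perm => [||v]; rewrite ?filter_uniq // !mem_filter andbC.
  have bound (X Y : seq {poly F}) : count (mem Y) X = c -> size X = size A ->
      `|\sum_(v <- X | v \notin Y) g v| <= (size A)%:R - c%:R.
    move=> XY sX; apply: le_trans (ler_norm_sum _ _ _) _.
    rewrite (eq_bigr (fun=> 1)); last by move=> v _; exact: g1.
    rewrite big_const_seq iter_addr_0 -natrB -?sX -?XY ?count_size //.
    by rewrite -(count_predC (mem Y) X) addnC addnK.
  rewrite -(big_map (fun u => u + h) xpredT) -/B.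
  rewrite (bigID (mem B)) /= [X in _ - X](bigID (mem A)) /=.
  rewrite -big_filter -[X in _ - (X + _)]big_filter (perm_big _ cap) /=.
  rewrite opprD addrACA subrr add0r.
  apply: le_trans (ler_normB _ _) _.
  have b1 := bound A B (esym cE) (erefl _).
  have b2 : `|\sum_(v <- B | v \notin A) g v| <= (size A)%:R - c%:R.
    apply: bound; last by rewrite size_map.
    by rewrite cE -!size_filter (perm_size cap).
  apply: le_trans (lerD b1 b2) _.
  have : ratr `|c%:R / (size A)%:R - 1| <= eps / 4 :> algC.
    by apply: le_trans qE; rewrite ler_rat ltW.
  rewrite ratr_norm rmorphB rmorph1 fmorph_div !rmorph_nat distrC => cq.
  have : 1 - c%:R / (size A)%:R <= eps / 4.
    apply: le_trans cq; apply: real_ler_norm.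
    by rewrite rpredB ?rpred1 // rpred_div // rpred_nat.
  rewrite -(ler_pM2r sF) mulrBl mul1r divfK ?gt_eqF // => cS.
  apply: le_trans (lerD cS cS) _.
  rewrite -mulrDl (_ : eps / 4 + eps / 4 = eps / 2) //.
  by field.
have m0 : 0 < (size H)%:R :> algC by rewrite ltr0n lt0n size_eq0.
rewrite -(ler_pM2l m0) -{1}(ger0_norm (ltW m0)) -normrM.
have -> : (size H)%:R * \sum_(u <- Fs N) g u =
    \sum_(h <- H) (\sum_(u <- Fs N) g u - \sum_(u <- Fs N) g (u + h)) +
    \sum_(u <- Fs N) \sum_(h <- H) g (u + h).
  rewrite sumrB [X in _ + X]exchange_big /= subrK big_const_seq count_predT iter_addr_0.
  by rewrite mulr_natl.
apply: le_trans (ler_normD _ _) _.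
have b1 : `|\sum_(h <- H) (\sum_(u <- Fs N) g u - \sum_(u <- Fs N) g (u + h))|
    <= (size H)%:R * (eps / 2 * (size (Fs N))%:R).
  apply: le_trans (ler_norm_sum _ _ _) _; rewrite mulr_natl -sum_seq_const.
  by rewrite big_seq [leRHS]big_seq; apply: ler_sum.
have b2 : `|\sum_(u <- Fs N) \sum_(h <- H) g (u + h)|
    <= (size H)%:R * (eps / 2 * (size (Fs N))%:R).
  apply: le_trans (ler_norm_sum _ _ _) _.
  rewrite mulrA mulr_natr -sum_seq_const; apply: ler_sum => u _.
  by rewrite mulr_natl; exact: HP.
apply: le_trans (lerD b1 b2) _.
rewrite -mulrDr -mulrDl (_ : eps / 2 + eps / 2 = eps) //.
by field.
Qed.
End FolnerAverages.

(** * Characters of the additive group of row vectors *)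

Section Characters.
Variables (F : finFieldType) (M : nat).
Let V : finZmodType := 'rV[F]_M.
Let G : {group V} := [set: V]%G.

Lemma lin_irr (i : Iirr G) : 'chi_i \is a linear_char.
Proof.
by apply/char_abelianP; apply/centsP => x _ y _; exact: addrC.
Qed.

Lemma irrD (i : Iirr G) (x y : V) : 'chi_i (x + y) = 'chi_i x * 'chi_i y.
Proof. by rewrite -(lin_charM (lin_irr i)) ?inE. Qed.

Lemma irr_norm (i : Iirr G) (x : V) : `|'chi_i x| = 1.
Proof. by rewrite normC_lin_char ?lin_irr ?inE. Qed.

(** In an abelian group every centralizer is the whole group and every class a singleton. The
    identity is the Fourier expansion of the indicator of equality. *)
Lemma irr_orthogonality (x y : V) :
  \sum_i 'chi[G]_i x * ('chi_i y)^* = (#|F| ^ M)%:R *+ (x == y).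
Proof.
rewrite second_orthogonality_relation ?inE //.
have mC (u v : V) : (u * v = v * u)%g by exact: addrC.
have -> : 'C_G[x]%g = [set: V].
  by apply/setP => z; rewrite in_setI !in_setT; apply/cent1P; exact: mC.
rewrite cardsT card_mx mul1n; congr (_ *+ nat_of_bool _).
apply/imsetP/eqP => [[z _ ->]|->]; last by exists 1%g; rewrite ?inE ?conjg1.
by rewrite conjgE mC mulgK.
Qed.
End Characters.

(** * Multiplying a Laurent series by polynomials *)

Section LaurentProduct.
Variables (F : finFieldType) (alpha : laurent F).

Lemma mulLP_widen (f : {poly F}) n N : (size f <= N)%N ->
  mulLP alpha f n = \sum_(j < N) lcoef alpha (n - (j : nat)%:Z) * f`_j.
Proof.
move=> fN; rewrite /mulLP (big_ord_widen N (fun j => lcoef alpha (n - j%:Z) * f`_j) fN).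
rewrite big_mkcond; apply: eq_bigr => j _; case: ltnP => // fj.
by rewrite nth_default ?mulr0.
Qed.

Lemma mulLP_linear n : linear (fun f : {poly F} => mulLP alpha f n : F^o).
Proof.
move=> c f g; set N := maxn (size (c *: f + g)) (maxn (size f) (size g)).
rewrite (@mulLP_widen (c *: f + g) _ N) ?leq_maxl //.
rewrite (@mulLP_widen f _ N) ?(@mulLP_widen g _ N) ?leq_max ?leqnn ?orbT //.
rewrite scaler_sumr -big_split; apply: eq_bigr => j _ /=.
by rewrite coefD coefZ mulrDr /GRing.scale /= mulrCA.
Qed.

Lemma mulLPD n (f g : {poly F}) : mulLP alpha (f + g) n = mulLP alpha f n + mulLP alpha g n.
Proof. by have := mulLP_linear n 1 f g; rewrite !scale1r. Qed.

Lemma mulLPZ n c (f : {poly F}) : mulLP alpha (c *: f) n = c * mulLP alpha f n.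
Proof.
have := mulLP_linear n c f 0; rewrite !addr0 => ->.
by rewrite [X in _ + X]/mulLP size_poly0 big_ord0 addr0.
Qed.

Lemma mulLPB n (f g : {poly F}) : mulLP alpha (f - g) n = mulLP alpha f n - mulLP alpha g n.
Proof. by rewrite mulLPD -scaleN1r mulLPZ mulN1r. Qed.

Lemma mulLP_sum n (I : Type) (s : seq I) (f : I -> {poly F}) :
  mulLP alpha (\sum_(i <- s) f i) n = \sum_(i <- s) mulLP alpha (f i) n.
Proof.
apply: (big_morph (fun f => mulLP alpha f n)); first exact: mulLPD.
by rewrite /mulLP size_poly0 big_ord0.
Qed.

Lemma mulLP_mulXn n (f : {poly F}) i : mulLP alpha (f * 'X^i) n = mulLP alpha f (n - i%:Z).
Proof.
rewrite (@mulLP_widen (f * 'X^i) _ (i + size f)); last first.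
  by have [->|f0] := eqVneq f 0; rewrite ?mul0r ?size_poly0 // size_mulXn // addnC.
rewrite big_split_ord /= big1 ?add0r => [|j _]; last first.
  by rewrite coefMXn /= ltn_ord mulr0.
rewrite [RHS]/mulLP; apply: eq_bigr => j _ /=; rewrite coefMXn ltnNge leq_addr /= addKn.
by rewrite PoszD opprD addrA.
Qed.
End LaurentProduct.

(** * Leading fractional coefficients on an ideal *)

Section FractionalPart.
Variables (F : finFieldType) (M : nat).
Implicit Types alpha : laurent F.

Definition frac_row (x : int -> F) : 'rV[F]_M := \row_(i < M) x (- (i.+1)%:Z).

Definition frac_mul alpha (f : {poly F}) : 'rV[F]_M := frac_row (mulLP alpha f).

Lemma frac_mulB alpha : zmod_morphism (frac_mul alpha).
Proof. by move=> f g; apply/rowP => i; rewrite !mxE mulLPB. Qed.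

Lemma frac_mulZ alpha c f : frac_mul alpha (c *: f) = c *: frac_mul alpha f.
Proof. by apply/rowP => i; rewrite !mxE mulLPZ. Qed.

(** The image is a subspace. The coefficients of a nonzero functional killing it would form a
    polynomial [m] such that [w * m] carries [alpha] into the polynomials, making [alpha]
    rational. *)
Lemma frac_mul_surj alpha (w : {poly F}) : w != 0 -> ~ in_Q alpha ->
  forall v : 'rV[F]_M, exists x, frac_mul alpha (w * x) = v.
Proof.
move=> w0 alphaNQ.
pose S v := `[< exists x, frac_mul alpha (w * x) = v >].
have S0 : S 0 by apply/asboolP; exists 0; rewrite mulr0 zmod_morphism0 //; exact: frac_mulB.
(* The row space of [A] is the image: vectors outside it are replaced by zero rows. *)
pose A : 'M[F]_(#|{: 'rV[F]_M}|, M) :=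
  \matrix_(i, j) (if S (enum_val i) then enum_val i 0 j else 0).
have rowA i : S (row i A).
  case: (boolP (S (enum_val i))) => Si.
    rewrite (_ : row i A = enum_val i) //.
    by apply/rowP => j; rewrite !mxE Si.
  rewrite (_ : row i A = 0) //.
  by apply/rowP => j; rewrite !mxE (negbTE Si).
have rowS x : exists i, row i A = frac_mul alpha (w * x).
  exists (enum_rank (frac_mul alpha (w * x))); apply/rowP => j; rewrite !mxE enum_rankK.
  have -> : S (frac_mul alpha (w * x)) by apply/asboolP; exists x.
  by rewrite mxE.

suff Afull : row_full A.
  move=> v; have /submxP[u ->] := submx_full v Afull.
  have [X XP] := choice (fun i => asboolW (rowA i)).
  exists (\sum_i u 0 i *: X i); rewrite mulr_sumr zmod_morphism_sum; last exact: frac_mulB.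
  by rewrite mulmx_sum_row; apply: eq_bigr => i _; rewrite -scalerAr frac_mulZ XP.
rewrite -cokermx_eq0; apply/negPn/negP => /matrix0Pn[i0 [j0 m0]].
have Am x : \sum_i frac_mul alpha (w * x) 0 i * cokermx A i j0 = 0.
  have [i iE] := rowS x; have /matrixP/(_ i j0) := mulmx_coker A.
  by rewrite !mxE => E; rewrite -[RHS]E -iE; apply: eq_bigr => j _; rewrite !mxE.
apply: alphaNQ; pose m : {poly F} := \sum_(i < M) cokermx A i j0 *: 'X^i.
exists (w * m); split.
  rewrite mulf_neq0 //; apply/eqP => /polyP/(_ i0); rewrite coef0 /m coef_sum.
  rewrite (bigD1 i0) //= coefZ coefXn eqxx mulr1 big1 ?addr0 => [|i ii0].
    by move/eqP; exact/negP.
  by rewrite coefZ coefXn eq_sym (inj_eq val_inj) (negbTE ii0) mulr0.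
(* The negative index is [- n.+1]; the shift by [i] coming from [m] and the shift by [n] coming from
   ['X^n] exchange roles. *)
move=> [n //|n] _; rewrite mulr_sumr mulLP_sum -[RHS](Am 'X^n).
apply: eq_bigr => i _; rewrite -scalerAr mulLPZ mulrC !mxE !mulLP_mulXn; congr (mulLP _ _ _ * _).
by rewrite NegzE; lia.
Qed.
End FractionalPart.

(** * From character averages to cylinder counts *)

Lemma polyX_expr_inj (F : finFieldType) m n : 'X^m = 'X^n :> {poly F} -> m = n.
Proof. by move=> /(congr1 (fun f : {poly F} => size f)); rewrite !size_polyXn => -[]. Qed.

Theorem theorem1p2 (F : finFieldType) (p : nat) (Hp : p \in [pchar F])
  (K : seq nat) (HKu : uniq K) (HKpos : forall r, r \in K -> (0 < r)%N)
  (alpha : nat -> laurent F) (k : nat) (Hk : k \in K)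
  (Hi : ~~ (p %| k)%N)
  (Hii : forall v : nat, (0 < v)%N -> (p ^ v * k)%N \notin K)
  (Hiii : ~ in_Q (alpha k)) :
  well_distributed (Peval K alpha).
Proof.
move=> Fs FsP M a eps eps0.
have p_pr : prime p := pcharf_prime Hp.
have pP : p \in [pchar {poly F}] by rewrite pchar_poly.
pose G : {group 'rV[F]_M} := [set: 'rV[F]_M]%G.
pose row u : 'rV[F]_M := frac_row M (Peval K alpha u).
(* Each exponent is split into its [p]-part, absorbed into an additive map, and its prime-to-[p]
   part, kept as the new exponent. *)
pose s := undup [seq r`_p^' | r <- K]%N.
pose Phi r' (x : {poly F}) := \sum_(r <- K | (r`_p^')%N == r') frac_mul M (alpha r) (x ^+ (r`_p)%N).
have PhiB r : zmod_morphism (Phi r).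
  move=> x y; rewrite /Phi -sumrB; apply: eq_bigr => r' _.
  by rewrite p_part (expr_pX_additive pP) frac_mulB.
have rowE u : row u = frac_mul M (alpha 0%N) 1 + \sum_(r' <- s) Phi r' (u ^+ r').
  have -> : \sum_(r' <- s) Phi r' (u ^+ r') = \sum_(r <- K) frac_mul M (alpha r) (u ^+ r).
    rewrite /Phi (exchange_big_dep xpredT) //=; apply: eq_big_seq => r rK.
    rewrite -big_filter (_ : [seq _ <- s | _] = [:: (r`_p^')%N]).
      by rewrite big_seq1 -exprM mulnC partnC // HKpos.
    have rs : (r`_p^')%N \in s by rewrite mem_undup map_f.
    rewrite (eq_filter (a2 := pred1 (r`_p^')%N)) ?filter_pred1_uniq ?undup_uniq //.
    by move=> r'; rewrite /= eq_sym.
  apply/rowP => i; rewrite !mxE /Peval big_cons expr0 summxE; congr (_ + _).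
  by apply: eq_bigr => r _; rewrite !mxE.
(* By (i) the prime-to-[p] part of [k] is [k] itself, and by (ii) no other exponent in [K] shares
   it. *)
have Phik x : Phi k x = frac_mul M (alpha k) x.
  rewrite /Phi -big_filter (_ : [seq _ <- K | _] = [:: k]).
    by rewrite big_seq1 p_part lognE (negbTE Hi) !andbF expn0 expr1.
  rewrite -(filter_pred1_uniq HKu Hk); apply: eq_in_filter => r rK /=.
  have kk : (k`_p^' = k)%N by rewrite part_pnat_id // p'natE.
  apply/eqP/eqP => [rk|->//].
  have rE : r = (p ^ logn p r * k)%N by rewrite -p_part -rk partnC // HKpos.
  case: (posnP (logn p r)) => [l0|/Hii]; last by rewrite -rE rK.
  by rewrite rE l0 mul1n.
have mz (i : Iirr G) : i != 0 -> mean_zero (fun u => 'chi_i (row u)).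
  move=> i0; have := @mean_zero_power_sum {poly F} p 'X pP (@polyX_expr_inj F)
    algC _ 'chi_i (irrD i) (irr_norm i) s Phi k (undup_uniq _).
  move=> core; apply: (@mean_zero_ext _ _ (fun u => 'chi_i (frac_mul M (alpha 0%N) 1) *
     'chi_i (\sum_(r <- s) Phi r (u ^+ r)))).
    by move=> u; rewrite -irrD -rowE.
  apply: mean_zero_scale; first exact: irr_norm.
  apply: core => // [r||].
  - rewrite mem_undup => /mapP[r' r'K ->].
    by rewrite -p'natE // part_pnat.
  - rewrite mem_undup; apply/mapP; exists k => //.
    by rewrite part_pnat_id // p'natE.
  (* Were [Phi k] rational, surjectivity onto row vectors would make the character trivial. *)
  - move=> [w w0 wP]; case/eqP: i0; apply: irr_inj; rewrite irr0.
    apply/cfunP => v; rewrite cfun1E inE.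
    have [x <-] := frac_mul_surj w0 Hiii v.
    by rewrite -Phik wP.
pose q : nat := (#|F| ^ M)%N.
have q_gt0 : (0 < q)%N by rewrite expn_gt0 (leq_trans _ (finRing_gt1 F)).
(* At most [Nirr G] nontrivial characters contribute, so their total is at most [eps / 2] times the
   size. *)
pose eta : algC := ratr eps / (2 * (Nirr G)%:R).
have n0 : 0 < (Nirr G)%:R :> algC by rewrite ltr0n.
have eps0' : 0 < ratr eps :> algC by rewrite ltr0q.
have eta0 : 0 < eta by rewrite divr_gt0 // mulr_gt0 // ltr0n.
have exN (i : Iirr G) : exists N0, i != 0 -> forall N, (N0 <= N)%N ->
    `|\sum_(u <- Fs N) 'chi_i (row u)| <= eta * (size (Fs N))%:R.
  have [->|i0] := eqVneq i 0; first by exists 0%N.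
  have [N0 N0P] := folner_average (fun u => irr_norm i (row u)) (mz i i0) FsP eta0.
  by exists N0.
have [N0 N0P] := choice exN.
exists (\max_i N0 i)%N => N NN.
have S0 : 0 < (size (Fs N))%:R :> algC by rewrite ltr0n lt0n size_eq0 (FsP.1 N).2.
rewrite -(ltr_rat algC) ratr_norm rmorphB !fmorph_div rmorph1 !rmorph_nat /= -/q.
set S : algC := (size (Fs N))%:R in S0 *.
set c := count _ _.
(* Fourier expansion of the cylinder count; the trivial character yields the main term [S]. *)
have cE : q%:R * c%:R = \sum_i ('chi[G]_i (\row_j a j))^* * \sum_(u <- Fs N) 'chi_i (row u).
  under eq_bigr do rewrite mulr_sumr.
  rewrite exchange_big /c -sum1_count natr_sum big_mkcond mulr_sumr; apply: eq_bigr => u _ /=.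
  under eq_bigr do rewrite mulrC.
  rewrite irr_orthogonality -/q.
  have -> : in_cylinder (Peval K alpha u) a = (row u == \row_j a j).
    apply/forallP/eqP => [ua|ua i]; first by apply/rowP => i; rewrite !mxE; apply/eqP.
    by have /rowP/(_ i) := ua; rewrite !mxE => ->.
  by case: eqP => _; rewrite ?mulr1 ?mulr0.
have q0 : 0 < q%:R :> algC by rewrite ltr0n.
have dev : `|q%:R * c%:R - S| <= (Nirr G)%:R * (eta * S).
  rewrite cE (bigD1 0) //= irr0 !cfun1E inE /= rmorph1 mul1r.
  rewrite (eq_bigr (fun=> 1)); last by move=> u _; rewrite cfun1E inE.
  rewrite big_const_seq count_predT iter_addr_0 -/S addrAC subrr add0r.
  apply: le_trans (ler_norm_sum _ _ _) _.
  apply: le_trans (_ : \sum_(i < Nirr G | i != 0) eta * S <= _).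
    apply: ler_sum => i i0; rewrite normrM norm_conjC irr_norm mul1r.
    by apply: N0P => //; apply: leq_trans NN; exact: leq_bigmax.
  rewrite mulr_natl -[in leRHS](card_ord (Nirr G)) -sumr_const.
  rewrite [leLHS]big_mkcond; apply: ler_sum => i _; case: ifP => // _.
  by rewrite mulr_ge0 // ltW.
have -> : c%:R / S - 1 / q%:R = (q%:R * c%:R - S) / (q%:R * S).
  by field; rewrite !gt_eqF.
rewrite normrM normfV [X in _ / X]ger0_norm ?mulr_ge0 ?ltW // ltr_pdivrMr ?mulr_gt0 //.
apply: le_lt_trans dev _.
have -> : (Nirr G)%:R * (eta * S) = ratr eps / 2 * S.
  by rewrite /eta; move: ((Nirr G)%:R : algC) n0 => n n0; field; rewrite gt_eqF.
(* Strictness comes from [q >= 1], so that [eps / 2] is below [eps * q]. *)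
rewrite mulrA ltr_pM2r // ltr_pdivrMr ?ltr0n // -mulrA ltr_pMr // -natrM ltr1n.
by rewrite muln2 -addnn; case: (q) q_gt0 => // n _; rewrite addSn addnS.
Qed.
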